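(* Let $\xi\in\hat X\cap C^{1,1}([0,1],\Omega)$ have bounded curvature, i.e. there is $\overline\sigma>0$ with $\|\xi_\tau(a)-\xi_\tau(b)\|\le\overline\sigma|a-b|$ for all $a,b\in[0,1]$, and let $L=\|\xi_\tau\|$ be its length. Let $h>0$. Then the choice $$l=L\sqrt{\frac{h}{\overline\sigma}}\quad\Longleftrightarrow\quad h=\overline\sigma\frac{l^2}{L^2}$$ is optimal with respect to the error bound $2\overline\sigma\frac lL+2h\frac Ll+3h$ for $\|\xi_R(\xi)-\xi\|_{C^{0,1}([0,1])}$, i.e. it minimizes this expression over $l>0$. Moreover, if for this choice $l\le L$, then in every digraph that is $(h,l)$-dense in $\Omega$ the discrete approximation $\xi_R(\xi)$ satisfies $$\|\xi_R(\xi)-\xi\|_{L^\infty([0,1])}\le\frac{9\,\overline\sigma\,l^2}{8L^2},$$ $$\|(\xi_R(\xi)-\xi)_\tau\|_{L^\infty([0,1])}\le\frac{11\,\overline\sigma\,l}{2L},$$ $$\|\xi_R(\xi)-\xi\|_{C^{0,1}([0,1])}\le7\,\overline\sigma\,\frac lL .$$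
   Context: $x_O\neq x_D$ are points in $\mathbb{R}^2$ and $\Omega\subset\mathbb{R}^2$ is a (filled) ellipse with focal points $x_O,x_D$. $\|\cdot\|$ is the Euclidean norm on $\mathbb{R}^2$. $\hat X$ is the set of all $\xi\in C^{0,1}([0,1],\Omega)$ with $\xi(0)=x_O$, $\xi(1)=x_D$, and $\|\xi_\tau(\tau)\|$ equal to a constant (the path length) for almost all $\tau$. Norm on Lipschitz functions: $\|g\|_{C^{0,1}([0,1])}:=\|g\|_{L^\infty([0,1])}+\|g_\tau\|_{L^\infty([0,1])}$. Graphs: $G=(V,E)$ is a directed graph with a finite vertex set $V\subset\mathbb{R}^2$ containing $x_O$ and $x_D$, and $E\subset V\times V$. It is $(h,l)$-dense in the convex set $\Omega$, for $h,l\ge0$, if (1) $V\subset\Omega$; (2) for all $p\in\Omega$ there is $v\in V$ with $\|p-v\|\le h$; (3) for all $v,v'\in V$ with $\|v-v'\|\le l+2h$ one has $(v,v')\in E$. Rounding: given $\xi\in\hat X$ with length $L=\|\xi_\tau\|$ and an $(h,l)$-dense digraph with $l>0$, set $n=\lceil L/l\rceil$ and $\tau_i=i/n$ for $i=0,\dots,n$. Choose vertices $v_i\in V$ with $\|v_i-\xi(\tau_i)\|\le h$, with $v_0=x_O$, $v_n=x_D$. Then $\|v_i-v_{i+1}\|\le l+2h$, so $(v_i,v_{i+1})\in E$. The discrete approximation $\xi_R(\xi)$ is the piecewise linear interpolant $\xi_R(\tau)=v_{\lfloor n\tau\rfloor}+(n\tau-\lfloor n\tau\rfloor)(v_{\lceil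 n\tau\rceil}-v_{\lfloor n\tau\rfloor})$. The bounds are claimed for any such choice of the $v_i$. *)

(* Defs.v *)
From HB Require Import structures.
From mathcomp Require Import all_boot all_order all_algebra.
From mathcomp Require Import all_classical all_reals all_analysis.

Set Implicit Arguments.
Unset Strict Implicit.
Unset Printing Implicit Defensive.

Import Order.TTheory GRing.Theory Num.Theory.
Import numFieldNormedType.Exports.

Local Open Scope classical_set_scope.
Local Open Scope ring_scope.

Notation plane R := ('rV[R]_2).

(* The library norm `|p| on 'rV[R]_2 is the sup norm, so the Euclidean norm is
   introduced separately; both induce the same topology. *)
Definition enorm {R : realType} (p : plane R) : R :=
  Num.sqrt (\sum_(i < 2) p ord0 i ^+ 2).

Definition filled_ellipse {R : realType} (xO xD : plane R)
    (Omega : set (plane R)) : Prop :=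
  exists2 s : R, enorm (xO - xD) < s &
    Omega = [set p | enorm (p - xO) + enorm (p - xD) <= s].

(* A function on [0, 1] is represented by a function on R; every notion below
   only depends on its values on [0, 1]. *)
Definition unit_itv {R : realType} : set R := `[0, 1].

(* Difference quotients within [0, 1]: the two-sided derivative at interior
   points, the one-sided derivative at 0 and 1. *)
Definition slope01 {R : realType} (g : R -> plane R) (a : R) :
    set_system (plane R) :=
  ((b - a)^-1 *: (g b - g a)) @[b --> within unit_itv a^'].

Definition derivable01 {R : realType} (g : R -> plane R) (a : R) : Prop :=
  cvg (slope01 g a).

(* Meaningless where g is not derivable; for Lipschitz g this is a null set. *)
Definition derive01 {R : realType} (g : R -> plane R) (a : R) : plane R :=
  lim (slope01 g a).

Definition lipschitz01_with {R : realType} (K : R) (g : R -> plane R) : Prop :=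
  forall a b, unit_itv a -> unit_itv b -> enorm (g a - g b) <= K * `|a - b|.

(* C^{0,1}([0, 1], Omega) *)
Definition C01 {R : realType} (Omega : set (plane R)) : set (R -> plane R) :=
  [set g | (forall a, unit_itv a -> Omega (g a)) /\
           exists K, lipschitz01_with K g].

(* C^{1,1}([0, 1], Omega) *)
Definition C11 {R : realType} (Omega : set (plane R)) : set (R -> plane R) :=
  [set g | [/\ forall a, unit_itv a -> Omega (g a),
               forall a, unit_itv a -> derivable01 g a &
               exists K, lipschitz01_with K (derive01 g)]].

Definition const_speed {R : realType} (g : R -> plane R) (L : R) : Prop :=
  {ae @lebesgue_measure R,
    forall t, unit_itv t -> enorm (derive01 g t) = L}.

Definition Xhat {R : realType} (xO xD : plane R) (Omega : set (plane R)) :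
    set (R -> plane R) :=
  [set g | [/\ C01 Omega g, g 0 = xO, g 1 = xD & exists L, const_speed g L]].

Definition Linf01 {R : realType} (g : R -> plane R) : \bar R :=
  Lnorm (mrestr (@lebesgue_measure R) (measurable_itv `[0, 1])) +oo%E
    (EFin \o (enorm \o g)).

Definition C01_norm {R : realType} (g : R -> plane R) : \bar R :=
  (Linf01 g + Linf01 (derive01 g))%E.

Definition digraph {R : realType} (xO xD : plane R)
    (V : set (plane R)) (E : set (plane R * plane R)) : Prop :=
  [/\ finite_set V, V xO, V xD & E `<=` V `*` V].

Definition hl_dense {R : realType} (Omega : set (plane R)) (h l : R)
    (V : set (plane R)) (E : set (plane R * plane R)) : Prop :=
  [/\ V `<=` Omega,
      forall p, Omega p -> exists2 v, V v & enorm (p - v) <= h &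
      forall v v', V v -> V v' -> enorm (v - v') <= l + 2 * h -> E (v, v')].

Definition nb_segments {R : realType} (L l : R) : nat :=
  absz (Num.ceil (L / l)).

(* Only v 0, ..., v n matter. *)
Definition rounding {R : realType} (xO xD : plane R) (V : set (plane R))
    (h : R) (n : nat) (xi : R -> plane R) (v : nat -> plane R) : Prop :=
  [/\ forall i, (i <= n)%N -> V (v i) /\ enorm (v i - xi (i%:R / n%:R)) <= h,
      v 0%N = xO & v n = xD].

Definition interpolant {R : realType} (n : nat) (v : nat -> plane R) (t : R) :
    plane R :=
  let i := absz (Num.floor (n%:R * t)) in
  let j := absz (Num.ceil (n%:R * t)) in
  v i + (n%:R * t - i%:R) *: (v j - v i).

Definition error_bound {R : realType} (sigma L h l : R) : R :=
  2 * sigma * (l / L) + 2 * h * (L / l) + 3 * h.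

(* Main.v *)
(* Put e = l / L, so that h = sigma e^2, and let n be the number of segments.
   Since 1/n <= e and e <= 1, one has 1 <= n e <= 1 + e <= 2.  On each of the n
   cells the error splits into the error of the chord of xi, namely at most
   sigma / (8 n^2) for the values and sigma / n for the slopes, and the
   contribution of displacing the nodes by at most h, namely h and 2 h n.  This
   gives 9/8 sigma e^2 and 5 sigma e.  The nodes i / n are a null set. *)

Require Import Defs.
From HB Require Import structures.
From mathcomp Require Import all_boot all_order all_algebra.
From mathcomp Require Import all_classical all_reals all_analysis.
From mathcomp Require Import ess_sup_inf ring lra.

Set Implicit Arguments.
Unset Strict Implicit.
Unset Printing Implicit Defensive.

Import Order.TTheory GRing.Theory Num.Theory.
Import numFieldNormedType.Exports.

Local Open Scope classical_set_scope.
Local Open Scope ring_scope.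

(** * Euclidean inner product and norm on the plane *)

Section Euclid.
Context {R : realType}.
Implicit Types u v w : plane R.

Definition dotp u v : R := \sum_(i < 2) u ord0 i * v ord0 i.

Lemma dotpE u v :
  dotp u v = u ord0 ord0 * v ord0 ord0 + u ord0 ord_max * v ord0 ord_max.
Proof.
rewrite /dotp big_ord_recr/= big_ord1.
by have -> : widen_ord (leqnSn 1) ord0 = ord0 :> 'I_2 by exact: val_inj.
Qed.

Lemma enorm_ge0 u : 0 <= enorm u.
Proof. exact: sqrtr_ge0. Qed.

Lemma sqr_enorm u : enorm u ^+ 2 = dotp u u.
Proof.
rewrite /enorm sqr_sqrtr; last by apply: sumr_ge0 => i _; exact: sqr_ge0.
by apply: eq_bigr => i _; rewrite expr2.
Qed.

Lemma dotpDr u v w : dotp u (v + w) = dotp u v + dotp u w.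
Proof. by rewrite !dotpE !mxE; ring. Qed.

Lemma dotpBr u v w : dotp u (v - w) = dotp u v - dotp u w.
Proof. by rewrite !dotpE !mxE; ring. Qed.

Lemma dotpZr u k v : dotp u (k *: v) = k * dotp u v.
Proof. by rewrite !dotpE !mxE; ring. Qed.

(** Cauchy-Schwarz, from Lagrange's identity: the gap between the two squares is the square of the
    determinant of [u] and [v]. *)
Lemma dotp_le u v : dotp u v <= enorm u * enorm v.
Proof.
apply: real_ler_normlW; first exact: num_real.
rewrite -ler_sqr ?nnegrE ?mulr_ge0 ?enorm_ge0// real_normK ?num_real//.
rewrite exprMn !sqr_enorm !dotpE -subr_ge0.
set a := u _ _; set b := u _ _; set c := v _ _; set d := v _ _.
have -> : (a * a + b * b) * (c * c + d * d) - (a * c + b * d) ^+ 2 =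
  (a * d - b * c) ^+ 2 by ring.
exact: sqr_ge0.
Qed.

Lemma ler_enormD u v : enorm (u + v) <= enorm u + enorm v.
Proof.
rewrite -ler_sqr ?nnegrE ?addr_ge0 ?enorm_ge0//.
rewrite sqrrD !sqr_enorm.
have := dotp_le u v; rewrite !dotpE !mxE; lra.
Qed.

Lemma enormZ k u : enorm (k *: u) = `|k| * enorm u.
Proof.
apply/eqP; rewrite -(@eqrXn2 _ 2) ?mulr_ge0 ?enorm_ge0 //.
rewrite exprMn !sqr_enorm real_normK ?num_real// !dotpE !mxE.
by apply/eqP; ring.
Qed.

Lemma enormN u : enorm (- u) = enorm u.
Proof. by rewrite -scaleN1r enormZ normrN1 mul1r. Qed.

Lemma enorm0_eq0 u : enorm u = 0 -> u = 0.
Proof.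
move=> u0; have := sqr_enorm u; rewrite u0 expr0n/= dotpE -!expr2 => /esym/eqP.
rewrite paddr_eq0 ?sqr_ge0// !sqrf_eq0 => /andP[/eqP u00 /eqP u01].
apply/rowP => -[[|[|//]] i2]; rewrite mxE.
  by rewrite -[RHS]u00; congr (u _ _); exact: val_inj.
by rewrite -[RHS]u01; congr (u _ _); exact: val_inj.
Qed.

(** One factor [enorm w] cancels. This turns a norm bound on an error [w] into a bound on a scalar
    product with the fixed vector [w], to which the scalar mean value theorem applies. *)
Lemma enorm_le_dotp w c : 0 <= c -> dotp w w <= enorm w * c -> enorm w <= c.
Proof.
move=> c0; rewrite -sqr_enorm expr2.
have := enorm_ge0 w; rewrite le_eqVlt => /orP[/eqP<-//|w0].
by rewrite ler_pM2l.
Qed.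

End Euclid.

(** * Derivatives on the unit interval and their scalar projections *)

Section Calculus.
Context {R : realType}.
Implicit Types (g : R -> plane R) (t a b : R).

Lemma dotp_continuous (u : plane R) : continuous (dotp u).
Proof.
move=> v.
have -> : dotp u = (fun w : plane R => u ord0 ord0 * w ord0 ord0) \+
    (fun w : plane R => u ord0 ord_max * w ord0 ord_max).
  by apply/funext => w; rewrite dotpE.
have c i : u ord0 i * (w : plane R) ord0 i @[w --> v] --> u ord0 i * v ord0 i.
  exact: (cvgM (cvg_cst (u ord0 i)) (@coord_continuous R 1 2 ord0 i v)).
exact: (cvgD (c ord0) (c ord_max)).
Qed.

(** An interior point has a neighbourhood inside the unit interval, so there [slope01] is the
    ordinary two-sided difference quotient. *)
Lemma within_unit_dnbhs t : t \in `]0, 1[ -> within unit_itv t^' = t^'.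
Proof.
move=> t01; apply/seteqP; split=> A; rewrite /within /=.
  move=> H; have : \forall x \near t^', unit_itv x.
    apply: nbhs_dnbhs; apply: (filterS (P := `]0, 1[%classic)).
      by move=> x /=; rewrite /unit_itv /=; apply: subset_itv_oo_cc.
    exact: near_in_itvoo.
  by apply: filterS2 H => x.
by apply: filterS.
Qed.

Lemma derive01_unique g t (D : plane R) : t \in `]0, 1[ ->
  slope01 g t --> D -> derive01 g t = D.
Proof.
move=> t01; rewrite /derive01 /slope01 within_unit_dnbhs// => gD.
by apply: cvg_lim.
Qed.

(** Change of variable [b = h + t] between [slope01], with [b] tending to [t], and the directional
    derivative behind [is_derive], with [h] tending to 0. *)
Lemma cvg_shift_dnbhs t : (h *: 1 + t : R) @[h --> 0^'] --> t^'.
Proof.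
move=> A /nbhs_ballP[e /= e0 eA]; apply/nbhs_ballP; exists e => //= x xe x0.
apply: eA; first by move: xe; rewrite /ball/= sub0r opprD addrCA subrr addr0 scaler1.
by rewrite scaler1 -subr_eq0 addrK.
Qed.

Lemma is_derive_dotp g u t : t \in `]0, 1[ -> derivable01 g t ->
  is_derive t 1 (fun x => dotp u (g x)) (dotp u (derive01 g t)).
Proof.
move=> t01; rewrite /derivable01 /derive01 /slope01 within_unit_dnbhs// => gD.
have H : h^-1 *: (((fun x => dotp u (g x)) \o shift t) (h *: 1) - dotp u (g t))
    @[h --> 0^'] --> dotp u (lim ((b - t)^-1 *: (g b - g t) @[b --> t^'])).
  have := cvg_comp _ _ (cvg_shift_dnbhs (t := t))
    (cvg_comp _ _ gD (@dotp_continuous u _)).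
  apply: cvg_trans; apply: near_eq_cvg; near=> h => /=.
  by rewrite addrK scaler1 dotpZr dotpBr.
split; first by apply/cvg_ex; eexists; exact: H.
exact: cvg_lim H.
Unshelve. all: by end_near.
Qed.

Lemma lipschitz01_ge0 g K : lipschitz01_with K g -> 0 <= K.
Proof.
move=> gK; have := gK 0 1; rewrite sub0r normrN1 mulr1 => h.
by apply: (le_trans (enorm_ge0 _)); apply: h; rewrite /unit_itv/= in_itv/=; lra.
Qed.

End Calculus.

(** * Chord estimates for curves with Lipschitz derivative *)

Section Lipschitz_derivative.
Context {R : realType}.
Variables (g : R -> plane R) (K sigma : R).
Hypothesis gK : lipschitz01_with K g.
Hypothesis gD : forall t, unit_itv t -> derivable01 g t.
Hypothesis gS : lipschitz01_with sigma (derive01 g).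

Lemma dotp_lipschitz_continuous u a b : 0 <= a -> b <= 1 ->
  {within `[a, b], continuous (fun t => dotp u (g t))}.
Proof.
move=> a0 b1; apply/subspace_continuousP => x; rewrite /= in_itv/= => /andP[ax xb].
(* The summand 1 makes [M] positive even if [u] or [K] vanishes, so that [e / M] can serve as a
   radius. *)
set M : R := enorm u * `|K| + 1.
have M0 : 0 < M by rewrite ltr_wpDl ?mulr_ge0 ?enorm_ge0.
have lip y : 0 <= y -> y <= 1 ->
    forall z, 0 <= z -> z <= 1 -> dotp u (g y) - dotp u (g z) <= M * `|y - z|.
  move=> y0 y1 z z0 z1; rewrite -dotpBr; apply: (le_trans (dotp_le _ _)).
  have h : enorm (g y - g z) <= `|K| * `|y - z|.
    apply: le_trans (gK _ _) _; rewrite /unit_itv/= ?in_itv/= ?y0 ?z0//.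
    by rewrite ler_wpM2r// ler_norm.
  apply: (@le_trans _ _ (enorm u * (`|K| * `|y - z|))).
    by rewrite ler_wpM2l ?enorm_ge0.
  by rewrite mulrA /M mulrDl mul1r lerDl.
apply/cvgrPdist_lt => e e0; rewrite near_withinE; near=> y.
rewrite /= in_itv/= => /andP[ay yb].
have xy : `|x - y| < e / M by near: y; apply: cvgr_dist_lt => //; rewrite divr_gt0.
apply: (@le_lt_trans _ _ (M * `|x - y|)); last by rewrite mulrC -ltr_pdivlMr.
rewrite ler_norml lerNl opprB; apply/andP; split; last by apply: lip; lra.
by rewrite distrC; apply: lip; lra.
Unshelve. all: by end_near.
Qed.

(** The quadratic correction lets one statement serve two uses: [k = 0] is the plain mean value
    theorem, and [k = c / 2] prepares the convexity argument for [chord_error]. *)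
Lemma dotp_MVT u k a b : 0 <= a -> a < b -> b <= 1 ->
  exists2 c, a < c < b &
    (dotp u (g b) - k * b ^+ 2) - (dotp u (g a) - k * a ^+ 2) =
    (dotp u (derive01 g c) - k * (2 * c)) * (b - a).
Proof.
move=> a0 ab b1.
have [c|t|c] := @MVT R ((fun t => dotp u (g t)) - (fun t => k * t ^+ 2))
  (fun c => dotp u (derive01 g c) - k * (2 * c)) a b ab.
- rewrite in_itv/= => /andP[ac cb].
  apply: is_deriveB; first by apply: is_derive_dotp; [rewrite in_itv/=; lra|
    apply: gD; rewrite /unit_itv/= in_itv/=; lra].
  have -> : (fun t => k * t ^+ 2) = k \*: ((@id R) * (@id R)).
    by apply/funext => t; rewrite expr2.
  apply: is_derive_eq; rewrite /GRing.scale/=; ring.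
- apply: within_continuousB; first exact: dotp_lipschitz_continuous.
  apply: continuous_subspaceT => x.
  by apply: cvgM; [exact: cvg_cst|exact: exprn_continuous].
- by rewrite in_itv/= => acb E; exists c.
Qed.

(* For every w the function x |-> |w| sigma / 2 x^2 - <w, g x> has a monotone
   derivative, hence lies below its chords; take w to be the error itself. *)
Lemma chord_error a b t : 0 <= a -> a < t -> t < b -> b <= 1 ->
  enorm (((b - t) / (b - a)) *: g a + ((t - a) / (b - a)) *: g b - g t) <=
  sigma / 2 * ((t - a) * (b - t)).
Proof.
move=> a0 at_ tb b1; set w : plane R := (X in enorm X).
have s0 := lipschitz01_ge0 gS.
apply: enorm_le_dotp; first by clear -at_ tb s0; rewrite !mulr_ge0//; lra.
set c := enorm w * sigma.
have [p /andP[ap pt] Ep] := dotp_MVT w (c / 2) a0 at_ (ltac:(lra) : t <= 1).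
have [q /andP[tq qb] Eq] := dotp_MVT w (c / 2) (ltac:(lra) : 0 <= t) tb b1.
have pq : dotp w (derive01 g q) - dotp w (derive01 g p) <= c * (q - p).
  rewrite -dotpBr; apply: (le_trans (dotp_le _ _)).
  rewrite /c -mulrA ler_wpM2l ?enorm_ge0// -[q - p]ger0_norm; last by clear -pt tq; lra.
  by apply: gS; rewrite /unit_itv/= in_itv/=; clear -a0 b1 ap pt tq qb; lra.
(* The chord error is a weighted difference of the increments of [g] over the two sides of [t],
   which are then expressed through the mean value points [p] and [q]. *)
have -> : dotp w w = (((t - a) * (dotp w (g b) - dotp w (g t)) -
    (b - t) * (dotp w (g t) - dotp w (g a)))) / (b - a).
  rewrite {2}/w dotpBr dotpDr !dotpZr; clear -at_ tb; field; lra.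
rewrite ler_pdivrMr; last by clear -at_ tb; lra.
have Ep' : dotp w (g t) - dotp w (g a) =
    (dotp w (derive01 g p) - c * p) * (t - a) + c / 2 * (t ^+ 2 - a ^+ 2).
  by have -> : c * p = c / 2 * (2 * p); [field|rewrite -Ep; ring].
have Eq' : dotp w (g b) - dotp w (g t) =
    (dotp w (derive01 g q) - c * q) * (b - t) + c / 2 * (b ^+ 2 - t ^+ 2).
  by have -> : c * q = c / 2 * (2 * q); [field|rewrite -Eq; ring].
rewrite Ep' Eq' -subr_ge0.
set x := dotp w (derive01 g p) in pq *; set y := dotp w (derive01 g q) in pq *.
rewrite (_ : enorm w * _ = c / 2 * ((t - a) * (b - t))); last by rewrite /c; field.
(* The quadratic terms cancel, and the remaining slack is a positive factor times the slack in
   [pq]. *)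
have -> : c / 2 * ((t - a) * (b - t)) * (b - a) -
   ((t - a) * ((y - c * q) * (b - t) + c / 2 * (b ^+ 2 - t ^+ 2)) -
    (b - t) * ((x - c * p) * (t - a) + c / 2 * (t ^+ 2 - a ^+ 2))) =
  (t - a) * (b - t) * (c * (q - p) - (y - x)) by field.
by clear -at_ tb pq; rewrite !mulr_ge0//; lra.
Qed.

(** Paired with the error [w], the difference quotient equals the derivative at some intermediate
    [c], and [c] and [t] are at most [b - a] apart. *)
Lemma chord_slope_error a b t : 0 <= a -> a < b -> b <= 1 -> a <= t <= b ->
  enorm ((b - a)^-1 *: (g b - g a) - derive01 g t) <= sigma * (b - a).
Proof.
move=> a0 ab b1 /andP[at_ tb]; set w : plane R := (X in enorm X).
have s0 := lipschitz01_ge0 gS.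
apply: enorm_le_dotp; first by rewrite mulr_ge0//; lra.
have [c /andP[ac cb]] := dotp_MVT w 0 a0 ab b1; rewrite !mul0r !subr0 => Ec.
have -> : dotp w w = dotp w (derive01 g c - derive01 g t).
  by rewrite {2}/w [in LHS]dotpBr dotpZr dotpBr Ec mulrC mulfK ?dotpBr// subr_eq0 gt_eqF.
apply: (le_trans (dotp_le _ _)); rewrite ler_wpM2l ?enorm_ge0//.
apply: (@le_trans _ _ (sigma * `|c - t|)).
  by apply: gS; rewrite /unit_itv/= in_itv/=; lra.
by rewrite ler_wpM2l// ler_norml; lra.
Qed.

(** Serves to show that [L] is positive. The mean value theorem bounds the chord by the speed at one
    point [c], where the speed need not be [L]; it is [L] at points arbitrarily close to [c], and
    the derivative is continuous. *)
Lemma enorm_chord_le_speed L : const_speed g L -> enorm (g 1 - g 0) <= L.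
Proof.
move=> gL; set w := g 1 - g 0.
have [c /andP[c0 c1]] := dotp_MVT w 0 (lexx 0) ltr01 (lexx 1).
rewrite !mul0r !subr0 mulr1 -dotpBr -/w => Ec.
have wc : enorm w <= enorm (derive01 g c).
  by apply: enorm_le_dotp; [exact: enorm_ge0|rewrite Ec dotp_le].
apply: (le_trans wc); apply/ler_addgt0Pr => e e0.
have s1 : 0 < `|sigma| + 1 by rewrite ltr_wpDl.
(* Within distance [e / (|sigma| + 1)] of [c] the derivative moves by at most [e]; the minimum with
   1 keeps [s] in the unit interval. *)
have [s /andP[cs sm] sL] : exists2 s, c < s < Num.min 1 (c + e / (`|sigma| + 1)) &
    enorm (derive01 g s) = L.
  apply: contrapT => no; set m := Num.min _ _ in no.
  have cm : c < m by rewrite lt_min c1 ltrDl divr_gt0.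
  (* Without such an [s], an interval of positive length would lie in the exceptional null set. *)
  have : (@lebesgue_measure R).-negligible `]c, m[%classic.
    apply: negligibleS gL => s /=; rewrite in_itv/= => /andP[cs sm] h.
    apply: no; exists s; first by rewrite cs.
    apply: h; rewrite /unit_itv/= in_itv/=; move: sm; rewrite lt_min => /andP[s1' _]; lra.
  move=> /(@negligibleP _ _ _ (@lebesgue_measure R) _ (measurable_itv `]c, m[)) cm0.
  have := lebesgue_measure_itv `]c, m[; rewrite cm0/= lte_fin cm -EFinB => /eqP.
  by rewrite eqe eq_sym subr_eq0 gt_eqF.
move: sm; rewrite lt_min => /andP[s1' se].
rewrite -sL -[derive01 g c](subrK (derive01 g s)) addrC.
apply: (le_trans (ler_enormD _ _)); rewrite lerD2l.
apply: (@le_trans _ _ (sigma * `|c - s|)).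
  by apply: gS; rewrite /unit_itv/= in_itv/=; lra.
apply: (@le_trans _ _ ((`|sigma| + 1) * `|c - s|)).
  by rewrite ler_wpM2r// (le_trans (ler_norm _))// lerDl.
rewrite mulrC -ler_pdivlMr// ler_norml; lra.
Qed.

End Lipschitz_derivative.

(** * Essential suprema and the cells of the interpolant *)

Section Rounding.
Context {R : realType}.
Implicit Types g : R -> plane R.

Lemma Linf01_le g (N : set R) (c : R) : countable N -> 0 <= c ->
  (forall t, unit_itv t -> ~ N t -> enorm (g t) <= c) ->
  (Linf01 g <= c%:E)%E.
Proof.
move=> cN c0 gc; rewrite /Linf01 unlock; case: ifPn => [_|_]; last by rewrite lee_fin.
apply/ess_supP; exists (~` `[0, 1] `|` N).
have mN : measurable N by exact: countable_measurable.
split.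
- by apply: measurableU => //; exact: measurableC.
- rewrite /= /mrestr setIUl setICl set0U.
  by apply: countable_lebesgue_measure0; apply: sub_countable cN; apply: subset_card_le => x [].
- move=> t /= tgc; apply: contrapT => /not_orP[/contrapT t01 Nt]; apply: tgc.
  by rewrite lee_fin ger0_norm ?enorm_ge0// gc.
Qed.

(** Strictly inside a cell, floor and ceiling are the consecutive numbers [i] and [i.+1]; at a node
    they would coincide. *)
Lemma interpolantE (n i : nat) (v : nat -> plane R) (t : R) :
  i%:R < n%:R * t < i.+1%:R ->
  interpolant n v t = v i + (n%:R * t - i%:R) *: (v i.+1 - v i).
Proof.
move=> /andP[it ti]; rewrite /interpolant.
have -> : Num.floor (n%:R * t) = i%:Z.
  by apply: floor_def; rewrite rmorphD /= -!pmulrn natr1 ti ltW.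
have -> // : Num.ceil (n%:R * t) = i.+1%:Z.
by apply: ceil_def; rewrite rmorphB /= -!pmulrn -natr1 addrK it/= natr1 ltW.
Qed.

Lemma cell_of_point (n : nat) (t : R) : (0 < n)%N -> unit_itv t ->
  ~ range (fun i : nat => i%:R / n%:R : R) t ->
  exists2 i : nat, (i < n)%N & i%:R < n%:R * t < i.+1%:R.
Proof.
move=> n0; rewrite /unit_itv/= in_itv/= => /andP[t0 t1] tN.
have n0R : 0 < n%:R :> R by rewrite ltr0n.
have nt0 : 0 <= n%:R * t by rewrite mulr_ge0 // ltW.
have /andP[it ti] := truncn_itv nt0.
(* Strictness holds because [t] is not a node; it also gives [i < n], since [n * t] is at most
   [n]. *)
have {}it : (Num.truncn (n%:R * t))%:R < n%:R * t.
  rewrite lt_neqAle it andbT; apply/eqP => E; apply: tN.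
  by exists (Num.truncn (n%:R * t)) => //; rewrite E mulrC mulKf// gt_eqF.
exists (Num.truncn (n%:R * t)); last by rewrite it.
by rewrite -(ltr_nat R) (lt_le_trans it)// ler_piMr// ltW.
Qed.

Lemma nb_segments_bounds (L l : R) : 1 <= L / l ->
  L / l <= (nb_segments L l)%:R < L / l + 1.
Proof.
move=> Ll; rewrite /nb_segments.
have c0 : 0 <= Num.ceil (L / l) by rewrite ceil_ge0; lra.
rewrite pmulrn gez0_abs//.
have /andP[h1 h2] := ceil_itv (L / l); rewrite h2/= -ltrBlDr.
by move: h1; rewrite rmorphB.
Qed.

(** Points near [t] stay in the same open cell, where the interpolant is affine, so its difference
    quotient is exactly the constant [n * (v i.+1 - v i)]. *)
Lemma derive01_interpolantB (g : R -> plane R) (n i : nat) (v : nat -> plane R) t :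
  (i < n)%N -> i%:R < n%:R * t < i.+1%:R -> derivable01 g t ->
  derive01 (fun x => interpolant n v x - g x) t =
  n%:R *: (v i.+1 - v i) - derive01 g t.
Proof.
move=> ni /andP[it ti] gt.
have n0 : 0 < n%:R :> R by rewrite ltr0n (leq_ltn_trans _ ni).
have t01 : t \in `]0, 1[.
  rewrite in_itv/=; apply/andP; split.
    by rewrite -(pmulr_rgt0 _ n0) (le_lt_trans _ it).
  by rewrite -(ltr_pM2l n0) mulr1 (lt_le_trans ti)// ler_nat.
apply: derive01_unique => //.
have h : cst (n%:R *: (v i.+1 - v i)) x -
    (x - t)^-1 *: (g x - g t) @[x --> within unit_itv t^'] -->
    n%:R *: (v i.+1 - v i) - derive01 g t.
  by apply: cvgB; [exact: cvg_cst|exact: gt].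
move: h; rewrite /slope01 within_unit_dnbhs//; apply: cvg_trans.
apply: near_eq_cvg; near=> x.
have xt : x != t by near: x; exact: nbhs_dnbhs_neq.
have /andP[ix xi] : i%:R < n%:R * x < i.+1%:R.
  have : i%:R / n%:R < x < i.+1%:R / n%:R.
    have : x \in `]i%:R / n%:R, i.+1%:R / n%:R[.
      near: x; apply: nbhs_dnbhs; apply: near_in_itvoo.
      by rewrite in_itv/= ltr_pdivrMr// mulrC it/= ltr_pdivlMr// mulrC.
    by rewrite in_itv.
  by rewrite ltr_pdivrMr// ltr_pdivlMr// ![x * _]mulrC.
rewrite (interpolantE (i := i)) ?ix// (interpolantE (i := i)) ?it//.
set d := v i.+1 - v i.
have -> : v i + (n%:R * x - i%:R) *: d - g x - (v i + (n%:R * t - i%:R) *: d - g t)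
  = (x - t) *: (n%:R *: d) - (g x - g t).
  by apply/matrixP => p q; rewrite !mxE; ring.
by rewrite [in RHS]scalerBr [in RHS]scalerA mulVf ?scale1r// subr_eq0.
Unshelve. all: by end_near.
Qed.

End Rounding.

(** * Optimality of [l] and the three error bounds *)

Theorem theorem4 (R : realType) (xO xD : plane R) (Omega : set (plane R))
    (xi : R -> plane R) (sigma L h : R) :
  xO != xD ->
  filled_ellipse xO xD Omega ->
  Xhat xO xD Omega xi ->
  C11 Omega xi ->
  0 < sigma ->
  lipschitz01_with sigma (derive01 xi) ->
  const_speed xi L ->
  0 < h ->
  let l := L * Num.sqrt (h / sigma) in
  [/\ forall l', 0 < l' ->
        (l' = L * Num.sqrt (h / sigma) <-> h = sigma * (l' ^+ 2 / L ^+ 2)),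
      0 < l /\
      (forall l', 0 < l' ->
         error_bound sigma L h l <= error_bound sigma L h l') &
      l <= L ->
      forall (V : set (plane R)) (E : set (plane R * plane R)),
      digraph xO xD V E ->
      hl_dense Omega h l V E ->
      forall v : nat -> plane R,
      let n := nb_segments L l in
      rounding xO xD V h n xi v ->
      let err := fun t => interpolant n v t - xi t in
      [/\ (Linf01 err <= (9 * sigma * l ^+ 2 / (8 * L ^+ 2))%:E)%E,
          (Linf01 (derive01 err) <= (11 * sigma * l / (2 * L))%:E)%E &
          (C01_norm err <= (7 * sigma * (l / L))%:E)%E]].
Proof.
move=> xOD _ [[_ [K xiK]] xi0 xi1 _] [_ xiD _] s0 xiS xiL h0 l.
(* The endpoints differ, so the chord from [xO] to [xD] has positive length. *)
have L0 : 0 < L.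
  apply: lt_le_trans (enorm_chord_le_speed xiK xiD xiS xiL).
  rewrite lt_neqAle enorm_ge0 andbT eq_sym; apply/eqP => /enorm0_eq0/eqP.
  by rewrite xi0 xi1 subr_eq0 eq_sym; exact/negP.
set e := Num.sqrt (h / sigma) in l *.
have e0 : 0 < e by rewrite sqrtr_gt0 divr_gt0.
have he : h = sigma * e ^+ 2.
  by rewrite sqr_sqrtr ?divr_ge0 ?ltW// mulrC divfK// gt_eqF.
have l0 : 0 < l by rewrite mulr_gt0.
have lL : l / L = e by rewrite /l mulrAC divff ?mul1r// gt_eqF.
split.
- move=> l' l'0; split=> [->|].
    by rewrite he; clear -L0; field; rewrite gt_eqF.
  rewrite he => /(mulfI (negbT (gt_eqF s0))); rewrite -expr_div_n => /eqP.
  rewrite eqrXn2// ?divr_ge0 ?ltW// => /eqP ->.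
  by rewrite mulrC divfK// gt_eqF.
- split=> // l' l'0; rewrite /error_bound lerD2r lL.
  have -> : L / l = e^-1 by rewrite -lL invf_div.
  have -> : L / l' = (l' / L)^-1 by rewrite invf_div.
  have : 0 < l' / L by rewrite divr_gt0.
  move: (l' / L) => x x0; rewrite he -subr_ge0.
  (* With [x = l' / L], the excess of the bound over its value at [e] is a completed square. *)
  have -> : 2 * sigma * x + 2 * (sigma * e ^+ 2) * x^-1 -
     (2 * sigma * e + 2 * (sigma * e ^+ 2) * e^-1) =
     2 * sigma / x * (x - e) ^+ 2.
    by clear -x0 e0; field; rewrite !gt_eqF.
  by rewrite mulr_ge0 ?sqr_ge0// divr_ge0 ?mulr_ge0 ?ltW.
move=> leL V E _ _ v n [vn _ _] err.
have e1 : e <= 1 by rewrite -lL ler_pdivrMr// mul1r.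
(* Here [n] is the ceiling of [1 / e]; [e <= 1] ensures that this ceiling is at least 1. *)
have [n0 ne ne1] : [/\ 0 < n%:R :> R, 1 <= n%:R * e & n%:R * e < 1 + e].
  have /andP[] : e^-1 <= n%:R < e^-1 + 1.
    by rewrite -lL invf_div; apply: nb_segments_bounds; rewrite -invf_div lL invf_ge1.
  move=> n1 n2; split; first by rewrite (lt_le_trans _ n1)// invr_gt0.
    by rewrite -ler_pdivrMr// div1r.
  by rewrite -ltr_pdivlMr// mulrDl divff ?gt_eqF// div1r.
have nn0 : (0 < n)%N by rewrite -(ltr_nat R).
pose N : set R := range (fun i : nat => i%:R / n%:R : R).
have cN : countable N by exact: (sub_countable (card_image_le _ _) (countableP _)).
have vi i : (i <= n)%N -> enorm (v i - xi (i%:R / n%:R)) <= h by move=> /vn[].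
have n1e : n%:R^-1 <= e by rewrite -[leLHS]mul1r ler_pdivrMr// mulrC.
pose d i : plane R := v i - xi (i%:R / n%:R).
have cell t : unit_itv t -> ~ N t ->
    exists2 i, (i < n)%N & [/\ i%:R < n%:R * t < i.+1%:R,
      0 <= i%:R / n%:R :> R, i%:R / n%:R < t, t < i.+1%:R / n%:R &
      i.+1%:R / n%:R <= 1 :> R].
  move=> t01 tN; have [i ilt /[dup] iti /andP[it ti]] := cell_of_point nn0 t01 tN.
  exists i => //; split=> //.
  - by rewrite ltr_pdivrMr// mulrC.
  - by rewrite ltr_pdivlMr// mulrC.
  - by rewrite ler_pdivrMr// mul1r ler_nat.
have width i : i.+1%:R / n%:R - i%:R / n%:R = n%:R^-1 :> R.
  by rewrite -mulrBl -natr1 addrC addKr mul1r.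
have B1 : (Linf01 err <= (9 * sigma * l ^+ 2 / (8 * L ^+ 2))%:E)%E.
  have -> : 9 * sigma * l ^+ 2 / (8 * L ^+ 2) = sigma / 8 * e ^+ 2 + h.
    by rewrite he /l; clear -L0; field; rewrite gt_eqF.
  apply: (Linf01_le cN); first by rewrite addr_ge0 ?(ltW h0)// mulr_ge0 ?sqr_ge0// divr_ge0// ltW.
  move=> t t01 tN; have [i ilt [iti i0 it ti i1]] := cell t t01 tN.
  have := chord_error xiK xiD xiS i0 it ti i1.
  rewrite width invrK.
  set a := i%:R / n%:R in i0 it *; set b := i.+1%:R / n%:R in ti i1 *.
  set p := (b - t) * n%:R; set q := (t - a) * n%:R => ce.
  have p0 : 0 <= p by rewrite mulr_ge0 ?ltW// subr_gt0.
  have q0 : 0 <= q by rewrite mulr_ge0 ?ltW// subr_gt0.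
  have pq : p + q = 1.
    by rewrite /p /q -mulrDl addrA subrK width mulVf// gt_eqF.
  (* The error is the chord error of [xi] plus a convex combination of the node displacements
     [d]. *)
  have -> : err t = (p *: xi a + q *: xi b - xi t) + (p *: d i + q *: d i.+1).
    rewrite /err (interpolantE v iti) /d -/a -/b.
    have -> : n%:R * t - i%:R = q by rewrite /q /a; field; rewrite gt_eqF.
    have -> : p = 1 - q by rewrite -pq addrK.
    by apply/matrixP => x y; rewrite !mxE; ring.
  apply: (le_trans (ler_enormD _ _)); apply: lerD.
    apply: (le_trans ce); apply: (@le_trans _ _ (sigma / 8 * n%:R^-1 ^+ 2)).
      have -> : sigma / 2 * ((t - a) * (b - t)) = sigma / 2 * (p * q) * n%:R^-1 ^+ 2.
        by rewrite /p /q; clear -n0; field; rewrite gt_eqF.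
      rewrite ler_wpM2r ?sqr_ge0//.
      have -> : sigma / 8 = sigma / 2 * (4^-1) by field.
      rewrite ler_wpM2l ?divr_ge0 ?(ltW s0)//.
      have -> : p = 1 - q by rewrite -pq addrK.
      (* The product of the weights is at most 1/4, which turns [sigma / 2] into [sigma / 8]. *)
      have -> : (1 - q) * q = 4^-1 - (q - 2^-1) ^+ 2 by field.
      by rewrite gerBl sqr_ge0.
    by rewrite ler_wpM2l ?divr_ge0 ?(ltW s0)// lerXn2r ?nnegrE ?invr_ge0 ?(ltW n0) ?(ltW e0).
  apply: (le_trans (ler_enormD _ _)); rewrite !enormZ !ger0_norm//.
  rewrite -[leRHS]mul1r -pq mulrDl lerD// ler_wpM2l// vi//; exact: ltnW.
have B2 : (Linf01 (derive01 err) <= (11 * sigma * l / (2 * L))%:E)%E.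
  have -> : 11 * sigma * l / (2 * L) = 11 / 2 * sigma * e.
    by rewrite /l; clear -L0; field; rewrite gt_eqF.
  have c0 : 0 <= sigma * e by rewrite mulr_ge0 ?ltW.
  apply: (Linf01_le cN); first by rewrite -mulrA mulr_ge0.
  move=> t t01 tN; have [i ilt [iti i0 it ti i1]] := cell t t01 tN.
  rewrite (derive01_interpolantB (i := i))//; last exact: xiD.
  have := chord_slope_error xiK xiD xiS i0 (lt_trans it ti) i1.
  move=> /(_ t); rewrite (ltW it) (ltW ti) => /(_ isT); rewrite width invrK => ce.
  have -> : n%:R *: (v i.+1 - v i) - derive01 xi t =
    (n%:R *: (xi (i.+1%:R / n%:R) - xi (i%:R / n%:R)) - derive01 xi t) +
    n%:R *: (d i.+1 - d i).
    by apply/matrixP => x y; rewrite /d !mxE; ring.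
  apply: (le_trans (ler_enormD _ _)).
  apply: (@le_trans _ _ (sigma * e + n%:R * (h + h))).
    apply: lerD; first by apply: (le_trans ce); rewrite ler_wpM2l// ltW.
    rewrite enormZ ger0_norm ?ler_wpM2l ?(ltW n0)//.
    apply: (le_trans (ler_enormD _ _)); rewrite enormN lerD// vi//; exact: ltnW.
  (* As [n * e] is at most 2, this term is at most [4 * sigma * e]; the total of [5 * sigma * e]
     lies below the claimed 11/2. *)
  have -> : n%:R * (h + h) = 2 * (sigma * e) * (n%:R * e) by rewrite he; ring.
  have : sigma * e * (n%:R * e) <= sigma * e * 2.
    by rewrite ler_wpM2l// (le_trans (ltW ne1))// -[2]/(1 + 1) lerD2l.
  move: c0; clear; lra.
split=> //; rewrite /C01_norm; apply: (le_trans (leeD B1 B2)).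
rewrite -EFinD lee_fin lL.
(* The last factor is at most 9/8 + 11/2 = 53/8 because [e <= 1], hence below 7. *)
have -> : 9 * sigma * l ^+ 2 / (8 * L ^+ 2) + 11 * sigma * l / (2 * L) =
  sigma * e * (9 / 8 * e + 11 / 2).
  by rewrite /l; clear -L0; field; rewrite gt_eqF.
rewrite -[leRHS]mulrA [leRHS]mulrC ler_wpM2l ?mulr_ge0 ?(ltW s0) ?(ltW e0)//.
by move: e1; clear; lra.
Qed.
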